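(* Let $n\ge 4$ and let $(a_i)_{i\in\mathbb Z}$, $(b_i)_{i\in\mathbb Z}$ be $n$-periodic sequences of real (or complex) numbers: $a_{i+n}=a_i$, $b_{i+n}=b_i$. The numerical 2-frieze pattern $F(a_i,b_i)$ is closed (of width $n-4$) if and only if the monodromy $M$ of the difference equation $$V_i=a_i\,V_{i-1}-b_i\,V_{i-2}+V_{i-3}\qquad(i\in\mathbb Z)$$ is trivial: $M=\mathrm{Id}$.
   Context: Indices $(p,q)$ of a 2-frieze range over pairs in $\mathbb Z^2\cup(\mathbb Z+\tfrac12)^2$ with $p-q\ge -3$; the entries with $p-q=r$ form row $r$. A 2-frieze pattern satisfies the rule $$v_{p,q}=v_{p-\frac12,q-\frac12}\,v_{p+\frac12,q+\frac12}-v_{p-\frac12,q+\frac12}\,v_{p+\frac12,q-\frac12}$$ for all $(p,q)$ with $p-q\ge -2$ (each entry equals the determinant formed by its left, right, top and bottom neighbours). The algebraic 2-frieze $F(A_i,B_i)$, with $A_i,B_i$ ($i\in\mathbb Z$) independent formal variables, is the 2-frieze in which rows $-3$ and $-2$ consist of $0$'s, row $-1$ consists of $1$'s, $v_{i,i}=A_i$ and $v_{i-\frac12,i-\frac12}=B_i$ for $i\in\mathbb Z$ (row $0$), and the rows $r\ge1$ are determined by the rule in the field of rational functions; all its entries are polynomials in the $A_i,B_i$. The numerical 2-frieze $F(a_i,b_i)$ is the evaluation of $F(A_i,B_i)$ at $A_i=a_i$, $B_i=b_i$. $F(a_i,b_i)$ is closed of width $n-4$ if row $n-4$ consists of $1$'s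 and rows $n-3$ and $n-2$ consist of $0$'s. Monodromy: the space of scalar solutions of the difference equation is 3-dimensional; choosing three independent solutions gives a sequence of vectors $V_i$ in $\mathbb R^3$ (or $\mathbb C^3$), and by periodicity of the coefficients there is a matrix $M\in \mathrm{SL}_3$, the monodromy, such that $V_{i+n}=M(V_i)$ for all $i$. *)

(* Defs.v *)
From HB Require Import structures.
From mathcomp Require Import all_boot all_order all_algebra finmap.
From mathcomp.multinomials Require Import monalg.
From mathcomp Require Import zify ring.

Set Implicit Arguments.
Unset Strict Implicit.
Unset Printing Implicit Defensive.

Import Order.TTheory GRing.Theory Num.Theory.

Local Open Scope ring_scope.
Local Notation "1" := (@mone _) : monom_scope.
Local Notation "x * y" := (mmul x y) : monom_scope.

(* {malg R[cmonom I]} is the ring of polynomials with coefficients in R in the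
   variables indexed by I, which may be infinite. It is shown to be an integral
   domain, so that its field of fractions is available, by Kronecker
   substitution: finitely many monomials are sent injectively to powers of 'X. *)
Section PolynomialDomain.
Variables (I : countType) (R : idomainType).

Let digits_inj (N L : nat) (f g : nat -> nat) :
    (forall k, k < L -> f k < N)%N -> (forall k, k < L -> g k < N)%N ->
    (\sum_(k < L) f k * N ^ k = \sum_(k < L) g k * N ^ k)%N ->
  forall k, (k < L)%N -> f k = g k.
Proof.
elim: L f g => [//|L IH] f g fN gN; rewrite !big_ord_recl /= !expn0 !muln1.
have sh (h : nat -> nat) : (\sum_(i < L) h (lift ord0 i) * N ^ (lift ord0 i) =
    (\sum_(i < L) h i.+1 * N ^ i) * N)%N.
  rewrite big_distrl /=; apply: eq_bigr => i _.
  by rewrite /bump /= add1n expnSr mulnA.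
rewrite !sh => E.
have N0 : (0 < N)%N by apply: leq_ltn_trans (fN 0%N _).
have E0 : f 0%N = g 0%N.
  have := congr1 (modn^~ N) E.
  by rewrite /= ![(_ + _ * N)%N]addnC !modnMDl !modn_small ?fN ?gN.
move: E; rewrite E0 => /addnI /eqP; rewrite eqn_pmul2r // => /eqP E1.
case=> [//|k] ltk.
by apply: (IH (fun k => f k.+1) (fun k => g k.+1)) => // j jL;
  [apply: fN | apply: gN].
Qed.

Let ex (m : cmonom I) (k : nat) : nat := oapp m 0%N (pickle_inv k).

Let w N L (m : cmonom I) : nat := (\sum_(k < L) ex m k * N ^ k)%N.

Let kmon N L (m : cmonom I) : {poly R} := 'X^(w N L m).

Let kmon_mult N L : mmorphism (kmon N L).
Proof.
have ex1 k : ex 1%M k = 0%N by rewrite /ex; case: pickle_inv => //= i; exact: cm1.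
have exM m1 m2 k : ex (m1 * m2)%M k = (ex m1 k + ex m2 k)%N.
  by rewrite /ex; case: pickle_inv => //= i; exact: cmM.
split=> [m1 m2|]; rewrite /kmon /w.
  by rewrite -exprD -big_split /=; congr ('X^_); apply: eq_bigr => k _;
     rewrite exM mulnDl.
by rewrite big1 ?expr0 // => k _; rewrite ex1.
Qed.

HB.instance Definition _ N L := isMultiplicative.Build _ _ _ (kmon_mult N L).

Let w_inj (d : {fset cmonom I}) :
  exists N L, {in d &, injective (w N L)}.
Proof.
pose L := (\max_(m <- d) \max_(i <- finsupp m) (choice.pickle i).+1)%N.
pose N := (\max_(m <- d) \max_(i <- finsupp m) (m i).+1).+1%N.
exists N, L => m1 m2 d1 d2 E.
have exN m k : m \in d -> (ex m k < N)%N.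
  move=> md; rewrite /ex; case: pickle_inv => //= i.
  case: (finsuppP m i) => // im; rewrite /N ltnS.
  apply: leq_trans _ (leq_bigmax_seq (P := xpredT)
    (F := fun m : cmonom I => \max_(i <- finsupp m) (m i).+1)%N _ md isT).
  by apply: leq_trans _ (leq_bigmax_seq (P := xpredT)
    (F := fun i => (m i).+1) _ im isT).
have out m i : m \in d -> ~~ (choice.pickle i < L)%N -> m i = 0%N.
  move=> md; case: (finsuppP m i) => // im /negP[].
  apply: leq_trans _ (leq_bigmax_seq (P := xpredT)
    (F := fun m : cmonom I => \max_(i <- finsupp m) (choice.pickle i).+1)%N _ md isT).
  exact: (leq_bigmax_seq (P := xpredT)
    (F := fun i => (choice.pickle i).+1) _ im isT).
apply/eqP/cmP => i; case: (boolP (choice.pickle i < L)%N) => iL; last by rewrite !out.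
have := @digits_inj N L (ex m1) (ex m2) (fun k _ => exN _ k d1) (fun k _ => exN _ k d2) E _ iL.
by rewrite /ex pickleK_inv.
Qed.

Let coef_mmap N L (d : {fset cmonom I}) (p : {malg R[cmonom I]}) m :
    {in d &, injective (w N L)} -> (msupp p `<=` d)%fset -> m \in d ->
  (mmap polyC (kmon N L) p)`_(w N L m) = p@_m.
Proof.
move=> winj pd md; rewrite (mmapEw pd) coef_sum (big_fsetD1 m) //=.
rewrite coefCM coefXn eqxx mulr1 big1_fset ?addr0 // => k; rewrite in_fsetD1.
case/andP=> kNm kd _; rewrite coefCM coefXn.
by case: eqP => [/(winj _ _ md kd) mk|_]; [rewrite mk eqxx in kNm | rewrite mulr0].
Qed.

Let malg_mulf_eq0 (p q : {malg R[cmonom I]}) : p * q = 0 -> (p == 0) || (q == 0).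
Proof.
move=> pq0; have [N [L winj]] := w_inj (msupp p `|` msupp q)%fset.
have z r : (msupp r `<=` msupp p `|` msupp q)%fset ->
    mmap polyC (kmon N L) r = 0 -> r == 0.
  move=> sr r0; apply/eqP/malgP => m; rewrite mcoeff0.
  case: msuppP => // mr; rewrite -(coef_mmap winj sr) ?r0 ?coef0 //.
  exact: (fsubsetP sr).
have /eqP : mmap polyC (kmon N L) p * mmap polyC (kmon N L) q = 0.
  by rewrite -rmorphM pq0 rmorph0.
rewrite mulf_eq0 => /orP[] /eqP /z->; rewrite ?orbT //.
  exact: fsubsetUl.
exact: fsubsetUr.
Qed.

Definition malg_unit : {pred {malg R[cmonom I]}} :=
  [pred p | (p == (p@_1%M)%:MP) && (p@_1%M \is a GRing.unit)].

Definition malg_inv (p : {malg R[cmonom I]}) : {malg R[cmonom I]} :=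
  if malg_unit p then ((p@_1%M)^-1)%:MP else p.

Let malg_mulVr : {in malg_unit, left_inverse 1 malg_inv *%R}.
Proof.
move=> p pU; rewrite /malg_inv ifT //; move/andP: pU => [/eqP pE pU].
by rewrite -[RHS]/(1%:MP) -(mulVr pU) mpolyCM -pE.
Qed.

Let malg_unitP (p q : {malg R[cmonom I]}) : q * p = 1 -> malg_unit p.
Proof.
move=> qp1; have [N [L winj]] := w_inj (1%M |` msupp p)%fset.
have p1 : 1%M \in (1%M |` msupp p)%fset by rewrite in_fset1U eqxx.
have sp : (msupp p `<=` 1%M |` msupp p)%fset by apply: fsubsetUr.
have w1 : w N L 1%M = 0%N.
  by rewrite /w big1 // => k _; rewrite /ex; case: pickle_inv => //= i; rewrite cm1.
have pU : mmap polyC (kmon N L) p \is a GRing.unit.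
  apply/unitrPr; exists (mmap polyC (kmon N L) q).
  by rewrite mulrC -rmorphM qp1 rmorph1.
move: pU; rewrite poly_unitE => /andP[/eqP sz].
rewrite -[X in _`_X]w1 (coef_mmap winj sp p1) => pU.
rewrite /malg_unit inE pU andbT; apply/eqP/malgP => m; rewrite mcoeffC.
case: (eqVneq 1%M m) => [<-//|m1]; case: msuppP => // mp.
have md := fsubsetP sp _ mp; rewrite mulr0n -(coef_mmap winj sp md).
apply: nth_default; rewrite sz lt0n -w1.
by apply: contra_neq m1 => /(winj _ _ md p1) ->.
Qed.

Let malg_inv_out : {in [predC malg_unit], malg_inv =1 id}.
Proof. by move=> p pU; rewrite /malg_inv ifN. Qed.

HB.instance Definition _ := GRing.ComNzRing_hasMulInverse.Build
  {malg R[cmonom I]} malg_mulVr malg_unitP malg_inv_out.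

HB.instance Definition _ := GRing.ComUnitRing_isIntegral.Build
  {malg R[cmonom I]} malg_mulf_eq0.

End PolynomialDomain.

(* inl i is the variable A_i, inr i the variable B_i. *)
Definition frieze_var : countType := (int + int)%type.

Definition frieze_ring := {malg int[cmonom frieze_var]}.
HB.instance Definition _ := GRing.IntegralDomain.on frieze_ring.

Definition frieze_X (x : frieze_var) : frieze_ring := << ucm x >>.

(* A pair (p, q) in Z^2 or (Z + 1/2)^2 with p - q integer is encoded by the two
   integers r = p - q and s = p + q; this is a bijection onto Z^2, since
   p = (s + r) / 2 and q = (s - r) / 2. Moving p and q by +-1/2 in the same
   direction changes s by +-1; moving them in opposite directions changes r. *)

Definition frieze_rule (S : pzRingType) (v : int -> int -> S) : Prop :=
  forall r s : int, -2 <= r ->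
    v r s = v r (s - 1) * v r (s + 1) - v (r - 1) s * v (r + 1) s.

(* Row 0: v_{i,i} = a_i sits at s = 2i and v_{i-1/2,i-1/2} = b_i at s = 2i - 1. *)
Definition base_row (T : Type) (a b : int -> T) (s : int) : T :=
  if (2 %| s)%Z then a (s %/ 2)%Z else b ((s + 1) %/ 2)%Z.

Section Rows.
Variables (F : fieldType) (c : int -> F).

(* Rows k - 1 and k, each new row being obtained from the rule in row k. *)
Fixpoint frieze_rows (k : nat) : (int -> F) * (int -> F) :=
  if k is k'.+1 then
    let: (u, w) := frieze_rows k' in
    (w, fun s => (w (s - 1) * w (s + 1) - w s) / u s)
  else (fun=> 1, c).

(* Rows below -3 are not part of the frieze; they are filled with 0's. *)
Definition frieze_entry (r s : int) : F :=
  match r with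
  | Posz k => (frieze_rows k).2 s
  | Negz 0 => 1
  | Negz _ => 0
  end.

End Rows.

Definition frieze_row0 : int -> frieze_ring :=
  base_row (fun i => frieze_X (inl i)) (fun i => frieze_X (inr i)).

Definition algebraic_frieze : int -> int -> {fraction frieze_ring} :=
  frieze_entry (fun s => tofrac (frieze_row0 s)).

Section Evaluation.
Variables (K : comNzRingType) (x : frieze_var -> K).

Definition monom_eval (m : cmonom frieze_var) : K :=
  \prod_(i <- finsupp m) x i ^+ m i.

Let monom_evalE (d : {fset frieze_var}) (m : cmonom frieze_var) :
  (finsupp m `<=` d)%fset -> monom_eval m = \prod_(i <- d) x i ^+ m i.
Proof.
move=> md; rewrite /monom_eval (big_fset_incl _ md) // => i _.
by rewrite -cmE_neq0 negbK => /eqP ->.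
Qed.

Let monom_eval_mult : mmorphism monom_eval.
Proof.
split=> [m1 m2|]; last by rewrite /monom_eval mdom1 big_seq_fset0.
rewrite {1}/monom_eval mdomD (monom_evalE (fsubsetUl _ (finsupp m2))).
rewrite (monom_evalE (fsubsetUr (finsupp m1) _)) -big_split /=.
by apply: eq_bigr => i _; rewrite cmM exprD.
Qed.

HB.instance Definition _ := isMultiplicative.Build _ _ _ monom_eval_mult.

Definition frieze_eval : frieze_ring -> K := mmap intr monom_eval.

HB.instance Definition _ := GRing.RMorphism.on frieze_eval.

Lemma frieze_evalX i : frieze_eval (frieze_X i) = x i.
Proof.
rewrite /frieze_eval /frieze_X mmapU /= mulr1z mul1r /= /monom_eval mdomU.
by rewrite big_seq_fset1 cmUU expr1.
Qed.

End Evaluation.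

(* The entries in closed form: continuant c k s is the entry in row k - 3. Along
   a diagonal (q fixed) the entries satisfy the difference equation. *)
Section Continuant.
Variables (S : comNzRingType) (c : int -> S).

Fixpoint continuant (k : nat) (s : int) : S :=
  match k with
  | ((k0.+1 as k1).+1 as k2).+1 =>
      c (s + k0%:Z) * continuant k2 (s - 1)
      - c (s + k0%:Z - 1) * continuant k1 (s - 2) + continuant k0 (s - 3)
  | 2 => 1
  | _ => 0
  end.

Let U := continuant.

Let US k (s : int) : U k.+3 s =
  c (s + k%:Z) * U k.+2 (s - 1) - c (s + k%:Z - 1) * U k.+1 (s - 2) + U k (s - 3).
Proof. by []. Qed.

Lemma continuant_row0 s : U 3 s = c s.
Proof. by rewrite /U /= addr0 mulr1 mulr0 subr0 addr0. Qed.

Lemma continuant_rule k s :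
  U k.+1 s = U k.+1 (s - 1) * U k.+1 (s + 1) - U k s * U k.+2 s.
Proof.
have U3 := continuant_row0.
have step j t t0 t1 t2 t3 : t0 = t + j%:Z -> t1 = t - 1 -> t2 = t - 2 ->
    t3 = t - 3 ->
    U j.+3 t = c t0 * U j.+2 t1 - c (t0 - 1) * U j.+1 t2 + U j t3.
  by move=> -> -> -> ->.
have [n] := ubnP k; elim: n k s => // n IH [s _|[s _|[s _|k s kn]]].
- by rewrite /U /=; ring.
- by rewrite /U /=; ring.
- rewrite (step 1 s (s + 1) (s - 1) _ _ erefl erefl erefl erefl) !U3 addrK.
  by rewrite /U /=; ring.
have e1 : U k.+4 s = c (s + k%:Z + 1) * U k.+3 (s - 1)
    - c (s + k%:Z) * U k.+2 (s - 2) + U k.+1 (s - 3).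
  rewrite (step k.+1 s (s + k%:Z + 1) (s - 1) (s - 2) (s - 3)) ?addrK //; lia.
have f0 : U k.+4.+1 s = c (s + k%:Z + 2) * U k.+4 (s - 1)
    - c (s + k%:Z + 1) * U k.+3 (s - 2) + U k.+2 (s - 3).
  rewrite (step k.+2 s (s + k%:Z + 2) (s - 1) (s - 2) (s - 3)) //; last by lia.
  by congr (_ - c _ * _ + _); lia.
have f1 : U k.+4 (s - 1) = c (s + k%:Z) * U k.+3 (s - 2)
    - c (s + k%:Z - 1) * U k.+2 (s - 3) + U k.+1 (s - 4).
  by rewrite (step k.+1 _ (s + k%:Z) (s - 2) (s - 3) (s - 4)) //; lia.
have g0 : U k.+4 (s + 1) = c (s + k%:Z + 2) * U k.+3 s
    - c (s + k%:Z + 1) * U k.+2 (s - 1) + U k.+1 (s - 2).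
  rewrite (step k.+1 _ (s + k%:Z + 2) s (s - 1) (s - 2)) //; try lia.
  by congr (_ - c _ * _ + _); lia.
have g1 : U k.+3 s = c (s + k%:Z) * U k.+2 (s - 1)
    - c (s + k%:Z - 1) * U k.+1 (s - 2) + U k (s - 3).
  by [].
have h1 := IH k.+2 (s - 1) ltac:(lia).
have h2 := IH k.+1 (s - 2) ltac:(lia).
have h3 := IH k (s - 3) ltac:(lia).
have n1 : s - 1 - 1 = s - 2 by lia.
have n2 : s - 2 - 1 = s - 3 by lia.
have n3 : s - 3 - 1 = s - 4 by lia.
have n4 : s - 2 + 1 = s - 1 by lia.
have n5 : s - 3 + 1 = s - 2 by lia.
rewrite n1 subrK in h1; rewrite n2 n4 in h2; rewrite n3 n5 in h3.
rewrite e1 h1 h2 h3 f0 g0.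
move: f1 g1.
set F1 := U k.+4 (s - 1); set F2 := U k.+3 (s - 2); set F3 := U k.+2 (s - 3).
set F4 := U k.+1 (s - 4); set G1 := U k.+3 s; set G2 := U k.+2 (s - 1).
set G3 := U k.+1 (s - 2); set G4 := U k (s - 3).
move=> -> ->; ring.
Qed.
End Continuant.

Lemma continuant_map (S T : comNzRingType) (f : {rmorphism S -> T}) c k s :
  f (continuant c k s) = continuant (f \o c) k s.
Proof.
have [n] := ubnP k; elim: n k s => // n IH [|[|[|k]]] s kn /=;
  rewrite ?rmorph0 ?rmorph1 //.
have h2 := IH k.+2 (s - 1) kn; have h1 := IH k.+1 (s - 2) (ltnW kn).
have h0 := IH k (s - 3) (ltnW (ltnW kn)).
by rewrite rmorphD rmorphB !rmorphM h0; congr (_ * _ - _ * _ + _).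
Qed.

Lemma continuant3 (c : int -> int) k s : (forall t, c t = 3) ->
  continuant c k s *+ 2 = k%:Z * (k%:Z - 1).
Proof.
move=> c3; have [n] := ubnP k; elim: n k s => // n IH [|[|[|k]]] s kn //.
have h2 := IH k.+2 (s - 1) kn.
have h1 := IH k.+1 (s - 2) (ltnW kn).
have h0 := IH k (s - 3) (ltnW (ltnW kn)).
rewrite [continuant _ _ _]/(c _ * continuant c k.+2 (s - 1) -
  c _ * continuant c k.+1 (s - 2) + continuant c k (s - 3)) !c3.
rewrite mulrnDl mulrnBl -!mulrnAr h0 h1 h2; lia.
Qed.

Arguments continuant : simpl never.

Lemma continuant_quot (S : comNzRingType) (c : int -> S) k s :
  continuant c k.+1 (s - 1) * continuant c k.+1 (s + 1) - continuant c k.+1 s =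
  continuant c k s * continuant c k.+2 s.
Proof. by rewrite [continuant c k.+1 s]continuant_rule; ring. Qed.

Lemma continuant_neq0 k s : continuant frieze_row0 k.+2 s != 0.
Proof.
apply/eqP => /(congr1 (frieze_eval (fun=> 3 : int))); rewrite rmorph0 continuant_map.
move=> E; have := @continuant3 (frieze_eval (fun=> 3 : int) \o frieze_row0) k.+2 s.
rewrite E mul0rn => /(_ _)/wrap[t|]; last by lia.
by rewrite /= /frieze_row0 /base_row; case: ifP; rewrite frieze_evalX.
Qed.

Lemma frieze_rowsE k s :
  (frieze_rows (fun t => tofrac (frieze_row0 t)) k).1 s = tofrac (continuant frieze_row0 k.+2 s) /\
  (frieze_rows (fun t => tofrac (frieze_row0 t)) k).2 s = tofrac (continuant frieze_row0 k.+3 s).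
Proof.
elim: k s => [|k IH] s.
  split; last by rewrite continuant_row0.
  by rewrite -[LHS](rmorph1 (@tofrac frieze_ring)).
rewrite /=; case: (frieze_rows _ _) IH => u w /= IH.
have [_ ->] := IH s; split=> //.
have [_ ->] := IH (s - 1); have [_ ->] := IH (s + 1); have [-> _] := IH s.
rewrite -rmorphM -rmorphB continuant_quot.
by rewrite rmorphM /= mulrC mulKf // tofrac_eq0 continuant_neq0.
Qed.

Lemma algebraic_frieze_poly r s :
  exists P : frieze_ring, tofrac P == algebraic_frieze r s.
Proof.
case: r => [k|[|k]]; last 2 first.
- by exists 1; rewrite rmorph1.
- by exists 0; rewrite rmorph0.
by have [_ E] := frieze_rowsE k s; exists (continuant frieze_row0 k.+3 s); rewrite -E.
Qed.

Lemma algebraic_friezeP : frieze_rule algebraic_frieze.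
Proof.
move=> r s; case: r => [k|[|[|k]]] // _.
- have [E1 E2] := frieze_rowsE k s; have [_ E3] := frieze_rowsE k.+1 s.
  have [_ E4] := frieze_rowsE k (s - 1); have [_ E5] := frieze_rowsE k (s + 1).
  have -> : k%:Z + 1 = k.+1 by lia.
  have -> : algebraic_frieze (k%:Z - 1) s = (frieze_rows (fun t => tofrac (frieze_row0 t)) k).1 s.
    case: k {E1 E2 E3 E4 E5} => [|k]; first by [].
    have -> : k.+1%:Z - 1 = k by lia.
    by rewrite /algebraic_frieze /=; case: frieze_rows.
  rewrite /algebraic_frieze /frieze_entry E1 E2 E3 E4 E5 -!rmorphM -rmorphB.
  by congr (tofrac _); exact: continuant_rule.
- by rewrite /algebraic_frieze /= mul0r subr0 mulr1.
- by rewrite /algebraic_frieze /= !mul0r subr0.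
Qed.

Section Numerical.
Variables (K : fieldType) (a b : int -> K).

(* The polynomial chosen is unique, since tofrac is injective. *)
Definition numerical_frieze (r s : int) : K :=
  frieze_eval (fun x => match x with inl i => a i | inr i => b i end)
    (xchoose (algebraic_frieze_poly r s)).

Definition frieze_closed (n : nat) : Prop :=
  forall s : int, [/\ numerical_frieze (n%:Z - 4) s = 1,
    numerical_frieze (n%:Z - 3) s = 0 & numerical_frieze (n%:Z - 2) s = 0].

Definition scalar_solution (y : int -> K) : Prop :=
  forall i, y i = a i * y (i - 1) - b i * y (i - 2) + y (i - 3).

(* The coordinate sequences of V are three independent scalar solutions. *)
Definition fundamental_solution (V : int -> 'cV[K]_3) : Prop :=
  (forall j, scalar_solution (fun i => V i j 0)) /\
  (forall l : 'I_3 -> K,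
     (forall i, \sum_j l j * V i j 0 = 0) -> forall j, l j = 0).

End Numerical.

Definition is_monodromy (K : fieldType) (n : nat) (V : int -> 'cV[K]_3)
    (M : 'M[K]_3) : Prop :=
  forall i, V (i + n%:Z) = M *m V i.

Section MonodromyTheory.
Variables (K : fieldType) (a b : int -> K).

Let window (V : int -> 'cV[K]_3) (i : int) : 'M[K]_3 :=
  \matrix_(j, k) V (i + k%:Z) j 0.

Let C (i : int) : 'M[K]_3 := \matrix_(j, k)
  (if k == 0 :> nat then (j == 1 :> nat)%:R
   else if k == 1 :> nat then (j == 2 :> nat)%:R
   else nth 0 [:: 1; - b (i + 3); a (i + 3)] j).

Let detC i : \det (C i) = 1.
Proof.
rewrite (expand_det_row _ 0) !big_ord_recl big_ord0 !mxE /= !mul0r !add0r addr0.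
rewrite mul1r /cofactor (expand_det_row _ 0) !big_ord_recl big_ord0 !mxE /=.
rewrite mul0r addr0 mul1r /cofactor det_mx11 !mxE /=.
by rewrite [LHS](_ : _ = (-1) ^+ 2 * ((-1) ^+ 0 * 1 + 0)) //; ring.
Qed.

Let windowS (V : int -> 'cV[K]_3) i : (forall j, scalar_solution a b (fun i => V i j 0)) ->
  window V (i + 1) = window V i *m C i.
Proof.
move=> sV; apply/matrixP => j k; rewrite !mxE !big_ord_recl big_ord0 !mxE /= addr0.
case: k => [[|[|[|//]]] ?] /=; rewrite ?mulr0 ?mulr1 ?add0r ?addr0.
- by [].
- by rewrite -addrA.
rewrite sV.
have -> : i + 1 + 2%:Z - 1 = i + 2%:Z by lia.
have -> : i + 1 + 2%:Z - 2 = i + 1%:Z by lia.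
have -> : i + 1 + 2%:Z - 3 = i by lia.
have -> : i + 1 + 2%:Z = i + 3 by lia.
by rewrite /bump /=; ring.
Qed.

Let C_unit i : C i \in unitmx.
Proof. by rewrite unitmxE detC unitr1. Qed.

Let int_step (P : int -> Prop) :
  P 0 -> (forall i, P i <-> P (i + 1)) -> forall i, P i.
Proof.
move=> P0 PS; elim/int_ind => [//|k /PS|k Pk]; first by rewrite -PoszD addn1.
by apply/PS; have -> : - k.+1%:Z + 1 = - k%:Z by lia.
Qed.

Lemma fundamental_solution_exists : exists V, fundamental_solution a b V.
Proof.
pose Wp := fix Wp k : 'M[K]_3 := if k is k'.+1 then Wp k' *m C k'%:Z else 1%:M.
pose Wn := fix Wn k : 'M[K]_3 :=
  if k is k'.+1 then Wn k' *m invmx (C (- k'.+1%:Z)) else 1%:M.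
pose W i := match i with Posz k => Wp k | Negz k => Wn k.+1 end.
have WS i : W (i + 1) = W i *m C i.
  case: i => [k|[|k]]; first by rewrite -PoszD addn1.
    by rewrite /= mul1mx mulVmx.
  have -> : Negz k.+1 + 1 = Negz k by lia.
  by rewrite /W [Wn k.+2]/= -mulmxA [Negz k.+1]NegzE mulVmx // mulmx1.
have W0 i j : W (i + 1) j 0 = W i j 1.
  by rewrite WS !mxE !big_ord_recl big_ord0 !mxE /= !mulr0 mulr1 !addr0 add0r; congr (W i j _); apply/val_inj.
have W1 i j : W (i + 1) j 1 = W i j 2%:R.
  rewrite WS !mxE !big_ord_recl big_ord0 !mxE /= !mulr0 mulr1 !addr0 !add0r.
  by congr (W i j _); apply/val_inj.
have W2 i j : W (i + 1) j 2%:R =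
    W i j 0 - b (i + 3) * W i j 1 + a (i + 3) * W i j 2%:R.
  rewrite WS !mxE !big_ord_recl big_ord0 !mxE /=.
  have -> : lift ord0 (ord0 : 'I_2) = 1 by apply/val_inj.
  have -> : lift ord0 (lift ord0 (ord0 : 'I_1)) = 2%:R by apply/val_inj.
  by ring.
exists (fun i => \col_j W i j 0); split=> [j i|l l0].
  rewrite !mxE; set t := i - 3.
  have -> : i = t + 1 + 1 + 1 by rewrite /t; lia.
  have -> : t + 1 + 1 + 1 - 2 = t + 1 by lia.
  have -> : t + 1 + 1 + 1 - 1 = t + 1 + 1 by lia.
  rewrite !W0 !W1 W2; have -> : t + 1 + 1 + 1 = t + 3 by lia.
  by ring.
have e i : \sum_j l j * W i j 0 = 0.
  by rewrite -[RHS](l0 i); apply: eq_bigr => j _; rewrite mxE.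
have lW k : \sum_j l j * W 0 j k = 0.
  case: k => [[|[|[|//]]] k3].
  - by rewrite -[RHS](e 0); apply: eq_bigr => j _; congr (_ * W _ _ _); apply/val_inj.
  - rewrite -[RHS](e (0 + 1)); apply: eq_bigr => j _; rewrite W0.
    by congr (_ * W _ _ _); apply/val_inj.
  - rewrite -[RHS](e (0 + 1 + 1)); apply: eq_bigr => j _; rewrite W0 W1.
    by congr (_ * W _ _ _); apply/val_inj.
move=> k; rewrite -[RHS](lW k) (bigD1 k) //= big1 ?addr0 => [|j jk].
  by rewrite mxE eqxx mulr1.
by rewrite mxE (negbTE jk) mulr0.
Qed.

Lemma monodromy_exists (n : nat) V :
    (forall i, a (i + n%:Z) = a i) -> (forall i, b (i + n%:Z) = b i) ->
    fundamental_solution a b V ->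
  exists M, [/\ is_monodromy n V M, \det M = 1 &
                forall M', is_monodromy n V M' -> M' = M].
Proof.
move=> an bn [sV lV].
have W0U : window V 0 \in unitmx.
  rewrite -row_free_unit -kermx_eq0; apply/eqP/row_matrixP => k; rewrite row0.
  set l := row k _; have l0 : l *m window V 0 = 0 by apply/sub_kermxP/row_sub.
  have lW : forall i, l *m window V i = 0.
    apply: int_step => // i; rewrite windowS // mulmxA; split=> [->|E].
      by rewrite mul0mx.
    by rewrite -[LHS](mulmxK (C_unit i)) E mul0mx.
  apply/rowP => j; rewrite [RHS]mxE; apply: (lV (fun j => l 0 j)) => i.
  have /rowP/(_ 0) := lW i; rewrite !mxE => E; rewrite -[RHS]E.
  by apply: eq_bigr => j' _; rewrite !mxE addr0.
have Cn i : C (i + n%:Z) = C i.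
  by apply/matrixP => j k; rewrite !mxE addrAC an bn.
pose M := window V n *m invmx (window V 0).
have MW : forall i, window V (i + n%:Z) = M *m window V i.
  apply: int_step => [|i]; first by rewrite add0r mulmxKV.
  rewrite addrAC !windowS // Cn mulmxA; split=> [->//|E].
  by rewrite -[LHS](mulmxK (C_unit i)) E mulmxK.
have detW : forall i, \det (window V i) = \det (window V 0).
  by apply: int_step => // i; rewrite windowS // det_mulmx detC mulr1.
exists M; split.
- move=> i; apply/matrixP => j k; rewrite (ord1 k) [RHS]mxE.
  have E := congr1 (fun A : 'M_3 => A j 0) (MW i).
  rewrite [LHS]mxE addr0 [RHS]mxE in E; rewrite E.
  by apply: eq_bigr => j' _; rewrite [window _ _ _ _]mxE addr0.
- rewrite det_mulmx det_inv detW mulfV //; by rewrite unitmxE unitfE in W0U.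
move=> M' M'V; rewrite -[LHS](mulmxK W0U); congr (_ *m _).
apply/matrixP => j k; rewrite mxE [RHS]mxE.
have -> : n%:Z + k%:Z = k%:Z + n%:Z by lia.
by rewrite M'V mxE; apply: eq_bigr => j' _; rewrite mxE add0r.
Qed.

End MonodromyTheory.

(* Main.v *)
Require Import Defs.
From mathcomp Require Import all_boot all_order all_algebra.
From mathcomp Require Import reals complex.
From mathcomp Require Import zify ring.
Set Implicit Arguments.
Unset Strict Implicit.
Unset Printing Implicit Defensive.
Import GRing.Theory Num.Theory.
Local Open Scope ring_scope.

(** A diagonal of the frieze with integral [q] is a solution of the difference
    equation: [p |-> v_{p,q}] takes the values 0, 0, 1 at [q - 3], [q - 2],
    [q - 1], and the recursion that defines the continuants is the difference
    equation itself ([impulse_solution]). Running the equation one step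
    backwards, this solution is 1, 0, 0 at [q - 4], [q - 3], [q - 2]. Now the
    frieze is closed of width [n - 4] precisely when the diagonals take the
    values 1, 0, 0 again [n] places further. As a solution is determined by
    three consecutive values and the coefficients are [n]-periodic, this says
    that these solutions, called impulses below, are [n]-periodic.

    If [M] is the identity, all solutions are [n]-periodic, which gives the
    three closing rows at the integral positions. The half-integral positions
    follow from the frieze rule alone, since the four neighbours of a
    half-integral entry are integral ([closed_of_integral_diagonals]).

    Conversely, if the frieze is closed, the impulses are periodic. Those that
    start at three consecutive places span all solutions, because their values
    form a unitriangular array ([impulse_forms_span]); hence every solution is
    periodic and [M] is the identity ([trivial_monodromy]). *)

(** * The numerical frieze as a table of continuants *)

Lemma continuantS (S : comNzRingType) (c : int -> S) k s :
  continuant c k.+3 s = c (s + k%:Z) * continuant c k.+2 (s - 1)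
    - c (s + k%:Z - 1) * continuant c k.+1 (s - 2) + continuant c k (s - 3).
Proof. by []. Qed.

Lemma eq_continuant (S : comNzRingType) (c d : int -> S) k s :
  c =1 d -> continuant c k s = continuant d k s.
Proof.
move=> cd; have [n] := ubnP k; elim: n k s => // n IH [|[|[|k]]] s kn //.
rewrite !continuantS !cd.
have h2 := IH k.+2 (s - 1) kn; have h1 := IH k.+1 (s - 2) (ltnW kn).
have h0 := IH k (s - 3) (ltnW (ltnW kn)).
by rewrite h0; congr (_ * _ - _ * _ + _).
Qed.

Lemma algebraic_friezeE k s :
  algebraic_frieze (k%:Z - 3) s = tofrac (continuant frieze_row0 k s).
Proof.
case: k => [|[|[|k]]]; rewrite ?rmorph0 ?rmorph1 //.
have -> : k.+3%:Z - 3 = k by lia.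
by have [_ <-] := frieze_rowsE k s.
Qed.

Lemma numerical_friezeE (K : fieldType) (a b : int -> K) k s :
  numerical_frieze a b (k%:Z - 3) s = continuant (base_row a b) k s.
Proof.
rewrite /numerical_frieze.
have /eqP := xchooseP (algebraic_frieze_poly (k%:Z - 3) s).
rewrite [RHS]algebraic_friezeE => /eqP; rewrite tofrac_eq => /eqP ->.
rewrite continuant_map; apply: eq_continuant => t.
by rewrite /= /frieze_row0 /base_row; case: ifP => _; rewrite frieze_evalX.
Qed.

(** The positions [2 q + k - 3] of row [k - 3] are those with integral [q]; they
    have one parity. In the frieze rule the left, right, top and bottom
    neighbours of an entry of the other parity all have integral [q], so the
    closing values 1, 0, 0 pass on to it. *)
Lemma closed_of_integral_diagonals (S : comNzRingType) (c : int -> S) k :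
    (forall q : int, [/\ continuant c k.+1 (2 * q + k.+1%:Z - 3) = 1,
      continuant c k.+2 (2 * q + k.+2%:Z - 3) = 0 &
      continuant c k.+3 (2 * q + k.+3%:Z - 3) = 0]) ->
  forall s, [/\ continuant c k.+1 s = 1, continuant c k.+2 s = 0 &
    continuant c k.+3 s = 0].
Proof.
move=> H.
have H1 t q : t = 2 * q + k.+1%:Z - 3 -> continuant c k.+1 t = 1.
  by move->; case: (H q).
have H2 t q : t = 2 * q + k.+2%:Z - 3 -> continuant c k.+2 t = 0.
  by move->; case: (H q).
have H3 t q : t = 2 * q + k.+3%:Z - 3 -> continuant c k.+3 t = 0.
  by move->; case: (H q).
move=> s; have [[q]|[q]] : (exists q, s = 2 * q + k%:Z) \/ (exists q, s = 2 * q + k%:Z + 1).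
- have := divz_eq (s - k%:Z) 2; have := modz_ge0 (s - k%:Z) (isT : 2 != 0 :> int).
  have := ltz_pmod (s - k%:Z) (isT : 0 < 2 :> int).
  by move=> h1 h2 h3; have [e|e] : ((s - k%:Z) %% 2)%Z = 0 \/ ((s - k%:Z) %% 2)%Z = 1;
    [lia|left|right]; exists ((s - k%:Z) %/ 2)%Z; lia.
- move=> ->; split.
  + by apply: (H1 _ (q + 1)); lia.
  + rewrite continuant_rule (H3 _ q); last by lia.
    rewrite (H2 _ q); last by lia.
    by rewrite mul0r mulr0 subrr.
  + by apply: (H3 _ q); lia.
move=> ->; split.
- rewrite continuant_rule (H1 _ (q + 1)); last by lia.
  rewrite (H1 _ (q + 2)); last by lia.
  rewrite (H2 _ (q + 1)); last by lia.
  by rewrite mulr1 mulr0 subr0.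
- by apply: (H2 _ (q + 1)); lia.
rewrite continuant_rule (H3 _ q); last by lia.
rewrite (H2 _ (q + 1)); last by lia.
by rewrite !mul0r subrr.
Qed.

(** * Solutions of the difference equation *)

Section Solutions.
Variables (K : fieldType) (a b : int -> K).

(** The equation can be run in both directions, as its last coefficient is 1. *)
Lemma solution_eq0 (f : int -> K) j : scalar_solution a b f ->
  f j = 0 -> f (j + 1) = 0 -> f (j + 2) = 0 -> forall i, f i = 0.
Proof.
move=> sf f0 f1 f2.
have sf3 t : f (t + 3) = a (t + 3) * f (t + 2) - b (t + 3) * f (t + 1) + f t.
  rewrite {1}sf; congr (_ * f _ - _ * f _ + f _); lia.
suff H d : [/\ f (j + d) = 0, f (j + d + 1) = 0 & f (j + d + 2) = 0].
  by move=> i; have [+ _ _] := H (i - j); have -> : j + (i - j) = i by lia.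
elim/int_ind: d => [|k [e0 e1 e2]|k [e0 e1 e2]]; first by rewrite addr0.
- have -> : j + k.+1%:Z = j + k%:Z + 1 by lia.
  have -> : j + k%:Z + 1 + 1 = j + k%:Z + 2 by lia.
  have -> : j + k%:Z + 1 + 2 = j + k%:Z + 3 by lia.
  by split=> //; rewrite sf3 e0 e1 e2 !mulr0 subrr addr0.
have t1 : j - k%:Z = j - k.+1%:Z + 1 by lia.
have t2 : j - k%:Z + 1 = j - k.+1%:Z + 2 by lia.
have t3 : j - k%:Z + 2 = j - k.+1%:Z + 3 by lia.
rewrite t1 in e0; rewrite t2 in e1; rewrite t3 in e2.
split=> //.
by have := sf3 (j - k.+1%:Z); rewrite e0 e1 e2 !mulr0 subrr add0r.
Qed.

Lemma solution_periodic (n : nat) (f : int -> K) j :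
    (forall i, a (i + n%:Z) = a i) -> (forall i, b (i + n%:Z) = b i) ->
    scalar_solution a b f ->
    f (j + n%:Z) = f j -> f (j + 1 + n%:Z) = f (j + 1) ->
    f (j + 2 + n%:Z) = f (j + 2) ->
  forall i, f (i + n%:Z) = f i.
Proof.
move=> an bn sf f0 f1 f2 i; apply/eqP; rewrite -subr_eq0; apply/eqP.
apply: (@solution_eq0 (fun i => f (i + n%:Z) - f i) j);
  rewrite ?f0 ?f1 ?f2 ?subrr // => t.
rewrite [f (t + n%:Z)]sf [f t]sf an bn.
have -> : t + n%:Z - 1 = t - 1 + n%:Z by lia.
have -> : t + n%:Z - 2 = t - 2 + n%:Z by lia.
have -> : t + n%:Z - 3 = t - 3 + n%:Z by lia.
by ring.
Qed.

(** With [q] fixed, each step along a diagonal changes the position by 1 and the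
    row by 1, so that the coefficients of the recursion of continuants are taken
    at [2 (q + k)] and [2 (q + k) - 1]: these are [a] and [b] at [q + k]. *)
Lemma impulse_solution (f : int -> K) q : scalar_solution a b f ->
    f (q - 3) = 0 -> f (q - 2) = 0 -> f (q - 1) = 1 ->
  forall k : nat, f (q + k%:Z - 3) = continuant (base_row a b) k (2 * q + k%:Z - 3).
Proof.
move=> sf f3 f2 f1 k; have [n] := ubnP k.
elim: n k => // n IH [|[|[|k]]] kn.
- by rewrite addr0 f3.
- by have -> : q + 1%:Z - 3 = q - 2 by lia.
- by have -> : q + 2%:Z - 3 = q - 1 by lia.
have -> : q + k.+3%:Z - 3 = q + k%:Z by lia.
have -> : 2 * q + k.+3%:Z - 3 = 2 * q + k%:Z by lia.
rewrite sf continuantS.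
have -> : 2 * q + k%:Z + k%:Z = (q + k%:Z) * 2 by lia.
have -> : base_row a b ((q + k%:Z) * 2) = a (q + k%:Z).
  by rewrite /base_row dvdz_mull // mulzK.
have -> : base_row a b ((q + k%:Z) * 2 - 1) = b (q + k%:Z).
  rewrite /base_row subrK mulzK // ifF //; lia.
have -> : q + k%:Z - 1 = q + k.+2%:Z - 3 by lia.
have -> : q + k%:Z - 2 = q + k.+1%:Z - 3 by lia.
rewrite !IH; try lia.
congr (_ * continuant _ _ _ - _ * continuant _ _ _ + continuant _ _ _); lia.
Qed.

Section Fundamental.
Variable V : int -> 'cV[K]_3.
Hypothesis fV : fundamental_solution a b V.

Lemma scalar_solution_mulmx (l : 'rV[K]_3) :
  scalar_solution a b (fun i => (l *m V i) 0 0).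
Proof.
move=> i; rewrite !mxE !mulr_sumr -sumrB -big_split /=.
by apply: eq_bigr => j _; have [sV _] := fV; rewrite sV; ring.
Qed.

Lemma form_eq0 j (l : 'rV[K]_3) : (l *m V j) 0 0 = 0 ->
  (l *m V (j + 1)) 0 0 = 0 -> (l *m V (j + 2)) 0 0 = 0 -> l = 0.
Proof.
move=> l0 l1 l2; apply/rowP => i; rewrite [RHS]mxE; have [_ lV] := fV.
apply: (lV (fun i => l 0 i)) => t.
rewrite -[RHS](solution_eq0 (scalar_solution_mulmx l) l0 l1 l2 t).
by rewrite !mxE.
Qed.

(** Any three consecutive values can be prescribed: a linear form that kills
    [V_j], [V_{j+1}], [V_{j+2}] is zero, so these vectors form a basis. *)
Lemma initial_values j (x : 'rV[K]_3) :
  exists l : 'rV[K]_3, forall k : 'I_3, (l *m V (j + k%:Z)) 0 0 = x 0 k.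
Proof.
pose W : 'M[K]_3 := \matrix_(i, k) V (j + k%:Z) i 0.
have lW (l : 'rV_3) k : (l *m W) 0 k = (l *m V (j + k%:Z)) 0 0.
  by rewrite !mxE; apply: eq_bigr => i _; rewrite mxE.
have WU : W \in unitmx.
  rewrite -row_free_unit -kermx_eq0; apply/eqP/row_matrixP => k; rewrite row0.
  set l := row k _; have l0 : l *m W = 0 by apply/sub_kermxP/row_sub.
  apply: (@form_eq0 j).
  - by have := lW l 0; rewrite l0 mxE addr0.
  - by have := lW l 1; rewrite l0 mxE.
  - by have := lW l 2%:R; rewrite l0 mxE.
by exists (x *m invmx W) => k; rewrite -lW mulmxKV.
Qed.

(** Since the coordinates of [V] form a basis of the solutions, solutions are
    represented by linear forms [l], standing for [i |-> l V_i]. *)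
Definition impulse_form q (l : 'rV[K]_3) : Prop :=
  [/\ (l *m V (q - 3)) 0 0 = 0, (l *m V (q - 2)) 0 0 = 0
    & (l *m V (q - 1)) 0 0 = 1].

Lemma impulse_form_exists q : exists l, impulse_form q l.
Proof.
have [l lx] := initial_values (q - 3) (\row_k (k == 2%:R)%:R).
exists l; split.
- by have := lx 0; rewrite [RHS]mxE addr0.
- by have := lx 1; rewrite [RHS]mxE /=; have -> : q - 3 + 1%:Z = q - 2 by lia.
- by have := lx 2%:R; rewrite [RHS]mxE /=; have -> : q - 3 + 2%:Z = q - 1 by lia.
Qed.

(** From any linear form one subtracts multiples of the impulse forms at 1, 2
    and 3 so as to kill its values at [V_0], [V_1] and [V_2] in turn. Each
    impulse vanishes at the two preceding places, so the zeros already made are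
    kept, and the form left is zero. *)
Lemma impulse_forms_span m (N : 'M[K]_(3, m)) :
  (forall q l, impulse_form q l -> l *m N = 0) -> N = 0.
Proof.
move=> H; apply/row_matrixP => i; rewrite rowE row0.
move: (delta_mx _ _) => l {i}.
have [u uP] := impulse_form_exists 1.
have [v vP] := impulse_form_exists 2; have [w wP] := impulse_form_exists 3.
have [[hu hv] hw] := (H _ _ uP, H _ _ vP, H _ _ wP).
case: uP vP wP => [_ _ u0] [_ v0 v1] [w0 w1 w2].
pose e (x : 'rV[K]_3) i := (x *m V i) 0 0.
pose al := e l 0; pose be := e l 1 - al * e u 1.
pose ga := e l 2 - al * e u 2 - be * e v 2.
have eE i : e (l - al *: u - be *: v - ga *: w) i =
    e l i - al * e u i - be * e v i - ga * e w i.
  by rewrite /e !mulmxBl -!scalemxAl !mxE.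
suff E : l - al *: u - be *: v - ga *: w = 0.
  rewrite -[l](subrK (al *: u)) -[l - _](subrK (be *: v)) -[l - _ - _](subrK (ga *: w)) E.
  by rewrite !mulmxDl -!scalemxAl hu hv hw !scaler0 mul0mx !addr0.
have {}u0 : e u 0 = 1 by [].
have {}v0 : e v 0 = 0 by [].
have {}v1 : e v 1 = 1 by [].
have {}w0 : e w 0 = 0 by [].
have {}w1 : e w 1 = 0 by [].
have {}w2 : e w 2 = 1 by [].
apply: (@form_eq0 0); rewrite ?add0r -/(e _ _) eE.
- by rewrite u0 v0 w0 /al; ring.
- by rewrite v1 w1 /be; ring.
- by rewrite w2 /ga; ring.
Qed.

End Fundamental.
End Solutions.

(** * Closed friezes and trivial monodromy *)

Section Monodromy.
Variables (K : fieldType) (a b : int -> K) (n : nat).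
Hypotheses (an : forall i, a (i + n%:Z) = a i) (bn : forall i, b (i + n%:Z) = b i).
Variables (V : int -> 'cV[K]_3) (M : 'M[K]_3).
Hypotheses (fV : fundamental_solution a b V) (MV : is_monodromy n V M).

Lemma trivial_monodromy :
    (forall q l, impulse_form V q l ->
       forall i, (l *m V (i + n%:Z)) 0 0 = (l *m V i) 0 0) ->
  M = 1%:M.
Proof.
move=> H; apply/eqP; rewrite -subr_eq0; apply/eqP.
apply: (impulse_forms_span fV) => q l lq.
have lV i : (l *m (M - 1%:M) *m V i) 0 0 = 0.
  rewrite -mulmxA mulmxBl mul1mx -MV mulmxBr [LHS]mxE [X in _ + X]mxE.
  by rewrite (H q) ?subrr.
exact: (form_eq0 fV (lV 0) (lV (0 + 1)) (lV (0 + 2))).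
Qed.

(** This is the first of the three values 1, 0, 0 that the closing rows repeat
    [n] places further. It lies before the beginning of the diagonal, in a row
    that the frieze does not have. *)
Lemma impulse_form_prev q l : impulse_form V q l -> (l *m V (q - 4)) 0 0 = 1.
Proof.
case=> l3 l2 l1; have := scalar_solution_mulmx fV l (q - 1).
have -> : q - 1 - 1 = q - 2 by lia.
have -> : q - 1 - 2 = q - 3 by lia.
have -> : q - 1 - 3 = q - 4 by lia.
by rewrite l1 l2 l3 !mulr0 subrr add0r.
Qed.

Lemma closed_iff_trivial_monodromy :
  (2 <= n)%N -> frieze_closed a b n <-> M = 1%:M.
Proof.
move=> n2; have [k nk] : exists k, n = k.+2 by exists n.-2; lia.
have rows : frieze_closed a b n <-> forall s,
    [/\ continuant (base_row a b) k.+1 s = 1, continuant (base_row a b) k.+2 s = 0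
      & continuant (base_row a b) k.+3 s = 0].
  have e1 : n%:Z - 4 = k.+1%:Z - 3 by lia.
  have e2 : n%:Z - 3 = k.+2%:Z - 3 by lia.
  have e3 : n%:Z - 2 = k.+3%:Z - 3 by lia.
  by rewrite /frieze_closed e1 e2 e3; split=> H s; have := H s;
    rewrite !numerical_friezeE.
have diag q l : impulse_form V q l -> forall m t, t = q + m%:Z - 3 ->
    continuant (base_row a b) m (2 * q + m%:Z - 3) = (l *m V t) 0 0.
  case=> l3 l2 l1 m t ->.
  exact/esym/(impulse_solution (scalar_solution_mulmx fV l) l3 l2 l1).
rewrite rows; split=> [closed|M1].
  apply: trivial_monodromy => q l lq.
  have l4 := impulse_form_prev lq; have [l3 l2 _] := lq.
  have [[[c1 _ _] [_ c2 _]] [_ _ c3]] := (closed (2 * q + k.+1%:Z - 3),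
    closed (2 * q + k.+2%:Z - 3), closed (2 * q + k.+3%:Z - 3)).
  apply: (solution_periodic (j := q - 4) an bn (scalar_solution_mulmx fV l)).
  - by rewrite l4 -c1; apply/esym/(diag q l lq); lia.
  - have -> : q - 4 + 1 = q - 3 by lia.
    by rewrite l3 -c2; apply/esym/(diag q l lq); lia.
  - have -> : q - 4 + 2 = q - 2 by lia.
    by rewrite l2 -c3; apply/esym/(diag q l lq); lia.
have Vn i : V (i + n%:Z) = V i by rewrite MV M1 mul1mx.
apply: closed_of_integral_diagonals => q.
have [l lq] := impulse_form_exists fV q.
have l4 := impulse_form_prev lq; have [l3 l2 _] := lq.
split.
- by rewrite (diag q l lq _ (q - 4 + n%:Z)) ?Vn //; lia.
- by rewrite (diag q l lq _ (q - 3 + n%:Z)) ?Vn //; lia.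
- by rewrite (diag q l lq _ (q - 2 + n%:Z)) ?Vn //; lia.
Qed.

End Monodromy.

Theorem theorem1 (R : realType) (n : nat) (hn : (4 <= n)%N) :
  (forall (a b : int -> R)
     (ha : forall i, a (i + n%:Z) = a i) (hb : forall i, b (i + n%:Z) = b i)
     (V : int -> 'cV[R]_3) (M : 'M[R]_3),
     fundamental_solution a b V -> is_monodromy n V M ->
     (frieze_closed a b n <-> M = 1%:M)) /\
  (forall (a b : int -> R[i])
     (ha : forall i, a (i + n%:Z) = a i) (hb : forall i, b (i + n%:Z) = b i)
     (V : int -> 'cV[R[i]]_3) (M : 'M[R[i]]_3),
     fundamental_solution a b V -> is_monodromy n V M ->
     (frieze_closed a b n <-> M = 1%:M)).
Proof.
have n2 : (2 <= n)%N by apply: leq_trans hn.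
by split=> a b ha hb V M fV MV; apply: (closed_iff_trivial_monodromy ha hb fV MV).
Qed.
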